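(* Let $p$ and $q$ be distinct prime numbers, both greater than $2$. Then the energy of the line graph $L(\Gamma(\mathbb{Z}_{pq}))$ is $4pq-8p-8q+16$.
   Context: For a positive integer $n$, $\mathbb{Z}_n$ is the ring of residue classes modulo $n$. The zero-divisor graph $\Gamma(\mathbb{Z}_n)$ is the simple undirected graph whose vertices are the nonzero zero-divisors of $\mathbb{Z}_n$ (nonzero $x \in \mathbb{Z}_n$ such that $xy = 0$ for some nonzero $y \in \mathbb{Z}_n$), with distinct vertices $x,y$ adjacent if and only if $xy=0$. The line graph $L(\Gamma(\mathbb{Z}_n))$ is the graph whose vertices are the edges of $\Gamma(\mathbb{Z}_n)$, two distinct vertices being adjacent if the corresponding edges share a common vertex in $\Gamma(\mathbb{Z}_n)$. The energy of a finite graph is the sum of the absolute values of the eigenvalues (counted with multiplicity) of its adjacency matrix. *)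

(* Defs.v *)
From HB Require Import structures.
From mathcomp Require Import all_boot all_order all_algebra.

Set Implicit Arguments.
Unset Strict Implicit.
Unset Printing Implicit Defensive.

Import GRing.Theory Num.Theory.
Local Open Scope ring_scope.

Record sgraph := SGraph {
  vertex :> finType;
  adj : rel vertex;
  adj_sym : symmetric adj;
  adj_irrefl : irreflexive adj
}.

Section LineGraph.
Variable G : sgraph.

Definition is_edge : pred {set G} :=
  [pred e | [exists x, exists y, adj x y && (e == [set x; y])]].

Definition edge : finType := {e : {set G} | is_edge e}.

Definition line_adj : rel edge :=
  fun e f => (e != f) && (val e :&: val f != set0).

Lemma line_adj_sym : symmetric line_adj.
Proof. by move=> e f; rewrite /line_adj eq_sym setIC. Qed.

Lemma line_adj_irrefl : irreflexive line_adj.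
Proof. by move=> e; rewrite /line_adj eqxx. Qed.

Definition line_graph : sgraph := SGraph line_adj_sym line_adj_irrefl.

End LineGraph.

Section ZeroDivisorGraph.
(* Pitfall: 'Z_n is Z/nZ only for n > 1 ('Z_0 and 'Z_1 are both Z/2Z). *)
Variable R : finComNzRingType.

Definition nonzero_zero_divisor : pred R :=
  [pred x | (x != 0) && [exists y, (y != 0) && (x * y == 0)]].

Definition zdg_vertex : finType := {x : R | nonzero_zero_divisor x}.

Definition zdg_adj : rel zdg_vertex :=
  fun x y => (x != y) && (val x * val y == 0).

Lemma zdg_adj_sym : symmetric zdg_adj.
Proof. by move=> x y; rewrite /zdg_adj eq_sym mulrC. Qed.

Lemma zdg_adj_irrefl : irreflexive zdg_adj.
Proof. by move=> x; rewrite /zdg_adj eqxx. Qed.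

Definition zero_divisor_graph : sgraph := SGraph zdg_adj_sym zdg_adj_irrefl.

End ZeroDivisorGraph.

Section Energy.
Variable C : numClosedFieldType.

(* With algebraic multiplicity; the order is unspecified. *)
Definition eigenvalues n (A : 'M[C]_n) : seq C :=
  sval (closed_field_poly_normal (char_poly A)).

Lemma char_poly_eigenvalues n (A : 'M[C]_n) :
  char_poly A = \prod_(z <- eigenvalues A) ('X - z%:P).
Proof.
rewrite /eigenvalues; case: closed_field_poly_normal => s /= {1}->.
by rewrite (monicP (char_poly_monic A)) scale1r.
Qed.

Definition adjacency_matrix (G : sgraph) : 'M[C]_#|G| :=
  \matrix_(i, j) (adj (enum_val i) (enum_val j))%:R.

Definition energy (G : sgraph) : C :=
  \sum_(z <- eigenvalues (adjacency_matrix G)) `|z|.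

End Energy.

(* Main.v *)
(* For a complete bipartite graph with parts of sizes a and b, the line graph is
   the a x b rook's graph, with adjacency matrix A = U + V - 2, where U and V
   are the matrices of "same row" and "same column". They satisfy U^2 = b U,
   V^2 = a V and U V = V U = (all ones), which forces the eigenvalues of A into
   {-2, a - 2, b - 2, a + b - 2}. On this set |z| = z - 4 h(z) / (a b (a + b))
   with h(z) = (z - (a - 2)) (z - (b - 2)) (z - (a + b - 2)), so the energy is
   the trace of a polynomial in A, and no multiplicity has to be computed. In
   Gamma(Z_pq) the parts are the multiples of p and the multiples of q. *)
Require Import Defs.
From mathcomp Require Import all_boot all_order all_algebra ring.

Set Implicit Arguments.
Unset Strict Implicit.

Import GRing.Theory Num.Theory.
Local Open Scope ring_scope.

(** * Eigenvalues and traces of polynomials in a matrix *)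

Lemma char_poly_conj (F : fieldType) n (P A : 'M[F]_n) :
  P \in unitmx -> char_poly (invmx P *m A *m P) = char_poly A.
Proof.
move=> Pu; rewrite /char_poly /char_poly_mx.
have PK : map_mx polyC (invmx P) *m map_mx polyC P = 1%:M.
  by rewrite -map_mxM mulVmx // map_mx1.
have -> : 'X%:M - map_mx polyC (invmx P *m A *m P) =
    map_mx polyC (invmx P) *m ('X%:M - map_mx polyC A) *m map_mx polyC P.
  rewrite mulmxBr mulmxBl scalar_mxC !map_mxM.
  by rewrite -(mulmxA _%:M) PK mulmx1.
by rewrite !det_mulmx mulrAC -det_mulmx PK det1 mul1r.
Qed.

(** Unitary diagonalization reduces the trace to a sum over a diagonal, which lists the eigenvalues
    because it has the same characteristic polynomial. *)
Lemma normal_mxtrace_horner (C : numClosedFieldType) n (A : 'M[C]_n.+1)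
    (p : {poly C}) :
  A \is normalmx -> \tr (horner_mx A p) = \sum_(z <- eigenvalues A) p.[z].
Proof.
move=> /orthomx_spectralP; set P := spectralmx A; set d := spectral_diag A.
have Pu : P \in unitmx by apply: spectral_unit.
move=> Aeq.
have ev : perm_eq (eigenvalues A) [seq d 0 i | i <- enum 'I_n.+1].
  apply: prod_XsubC_eq.
  rewrite -char_poly_eigenvalues [in LHS]Aeq char_poly_conj //.
  rewrite char_poly_trig ?diag_mx_is_trig //.
  rewrite big_map big_enum; apply: eq_bigr => i _.
  by rewrite mxE eqxx.
rewrite (perm_big _ ev) big_map big_enum [in LHS]Aeq horner_mx_uconjC //.
rewrite -mulmxA mxtrace_mulC mulmxK // horner_mx_diag mxtrace_diag.
by apply: eq_bigr => i _; rewrite mxE.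
Qed.

(** The minimal polynomial divides [p] and has the same roots as the characteristic polynomial. *)
Lemma eigenvalue_root_horner (C : numClosedFieldType) n (A : 'M[C]_n.+1) p z :
  horner_mx A p = 0 -> z \in eigenvalues A -> p.[z] = 0.
Proof.
move=> /mxminpoly_min pA; rewrite -root_prod_XsubC -char_poly_eigenvalues.
by rewrite -root_mxminpoly => /root_dvdp-/(_ _ pA)/rootP.
Qed.

(** * Matrices and energy of the rook's graph *)

Definition fiber_mx (C : nzRingType) n (I : eqType) (f : 'I_n -> I) : 'M[C]_n :=
  \matrix_(i, j) (f i == f j)%:R.

Section FiberMatrices.
Variables (C : comNzRingType) (n : nat) (I J : finType).
Variables (f : 'I_n -> I) (g : 'I_n -> J).
Hypothesis fg_bij : bijective (fun i => (f i, g i)).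

Lemma sum_fibers (F : I -> J -> C) :
  \sum_i F (f i) (g i) = \sum_x \sum_y F x y.
Proof.
have [h hK Kh] := fg_bij.
rewrite pair_bigA (reindex (fun i => (f i, g i))) //=.
by exists h => x _; rewrite ?hK ?Kh.
Qed.

Lemma sumr_delta (T : finType) (x : T) : \sum_y (y == x)%:R = 1 :> C.
Proof. by rewrite (bigD1 x) //= eqxx big1 ?addr0 // => y /negPf->. Qed.

(** Entry [(i, j)] counts the [k] with [f i = f k = f j]: a whole fiber, of size [#|J|], or
    nothing. *)
Lemma fiber_mx_sqr : fiber_mx C f *m fiber_mx C f = #|J|%:R *: fiber_mx C f.
Proof.
apply/matrixP => i j; rewrite !mxE.
under eq_bigr do rewrite !mxE -natrM mulnb.
rewrite (sum_fibers (fun x _ => ((f i == x) && (x == f j))%:R)).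
under eq_bigr do rewrite sumr_const andbC eq_sym.
rewrite sumrMnl -[LHS]mulr_natl; congr (_ * _).
have [->|ne] := eqVneq (f i) (f j).
  by under eq_bigr do rewrite eq_sym andbb; rewrite sumr_delta.
by rewrite big1 // => x _; have [<-|] := eqVneq (f j) x; rewrite ?(negPf ne).
Qed.

(** Entry [(i, j)] counts the indices with the first coordinate of [i] and the second of [j]:
    exactly one. *)
Lemma mul_fiber_mx : fiber_mx C f *m fiber_mx C g = const_mx 1.
Proof.
apply/matrixP => i j; rewrite !mxE.
under eq_bigr do rewrite !mxE eq_sym.
rewrite (sum_fibers (fun x y => (x == f i)%:R * (y == g j)%:R)).
under eq_bigr do rewrite -mulr_sumr sumr_delta mulr1.
exact: sumr_delta.
Qed.

End FiberMatrices.

Lemma rook_matrix_energy (C : numClosedFieldType) (I J : finType) n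
    (f : 'I_n -> I) (g : 'I_n -> J) (A := fiber_mx C f + fiber_mx C g - 2%:M) :
    bijective (fun i => (f i, g i)) -> (1 < #|I|)%N -> (1 < #|J|)%N ->
  \sum_(z <- eigenvalues A) `|z| = 4 * (#|I|%:R - 1) * (#|J|%:R - 1).
Proof.
move=> fg_bij I_gt1 J_gt1.
have n_card : (n = #|I| * #|J|)%N.
  by rewrite -card_prod -(bij_eq_card fg_bij) card_ord.
(* Exchanging the coordinates lets the same lemmas give [VV] and [VU]. *)
have gf_bij : bijective (fun i => (g i, f i)).
  have [h hK Kh] := fg_bij; exists (fun u => h (u.2, u.1)) => [i|[y x]] /=.
    exact: hK.
  by have [-> ->] := Kh (x, y).
case: n => [|n] in f g A fg_bij gf_bij n_card *.
  by have := muln_gt0 #|I| #|J|; rewrite -n_card (ltnW I_gt1) (ltnW J_gt1).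
set a : C := #|I|%:R; set b : C := #|J|%:R.
set U := fiber_mx C f in A *; set V := fiber_mx C g in A *.
have UU : U *m U = b *: U by apply: fiber_mx_sqr fg_bij.
have VV : V *m V = a *: V by apply: fiber_mx_sqr gf_bij.
have UV : U *m V = const_mx 1 by apply: mul_fiber_mx fg_bij.
have VU : V *m U = const_mx 1 by apply: mul_fiber_mx gf_bij.
set K := const_mx 1 in UV VU.
have KU : K *m U = b *: K by rewrite -VU -mulmxA UU -scalemxAr.
have KV : K *m V = a *: K by rewrite -UV -mulmxA VV -scalemxAr.
have a_gt1 : 1 < a by rewrite ltr1n.
have b_gt1 : 1 < b by rewrite ltr1n.
have a0 : a != 0 by rewrite pnatr_eq0 -lt0n ltnW.
have b0 : b != 0 by rewrite pnatr_eq0 -lt0n ltnW.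
have ab0 : a + b != 0 by rewrite -natrD pnatr_eq0 -lt0n ltn_addr // ltnW.
pose h : {poly C} :=
  ('X - (a - 2)%:P) * ('X - (b - 2)%:P) * ('X - (a + b - 2)%:P).
(* For [c] equal to [a], [b], [a + b] these are the factors of [h] at [A]; [c = 0] gives [A + 2]. *)
have A_sub c : A - (c - 2)%:M = U + V - c%:M.
  by rewrite /A -addrA -opprD -raddfD [2 + _]addrC subrK.
(* Rewriting with these rules makes every product linear in [U], [V], [K] and the identity, so
   [ring] can finish entrywise. *)
have expand := (mulmxDl, mulmxDr, mulNmx, mulmxN, mul_scalar_mx, mul_mx_scalar,
  UU, VV, UV, VU, KU, KV, =^~ scalemxAl).
have hA : horner_mx A h = (a + b) *: (a *: U + b *: V - K - (a * b)%:M).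
  rewrite /h !(rmorphM (horner_mx A)) !(rmorphB (horner_mx A)) /=.
  rewrite !horner_mx_X !horner_mx_C !A_sub.
  have -> : (U + V - a%:M) * (U + V - b%:M) =
    K *+ 2 - a *: U - b *: V + (a * b)%:M.
    rewrite -[LHS]/(_ *m _) !expand.
    by apply/matrixP => i j; rewrite !mxE; ring.
  rewrite -[LHS]/(_ *m _) mulr2n !expand.
  by apply/matrixP => i j; rewrite !mxE; ring.
(* Hence every eigenvalue is [-2] or a root of [h]. *)
have hA0 : horner_mx A (('X - (- 2)%:P) * h) = 0.
  rewrite mulrC (rmorphM (horner_mx A)) /= hA (rmorphB (horner_mx A)) /=.
  rewrite horner_mx_X horner_mx_C.
  rewrite -[- 2]add0r A_sub raddf0 subr0 -[LHS]/(_ *m _) !expand.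
  by apply/matrixP => i j; rewrite !mxE; ring.
have A_normal : A \is normalmx.
  apply: symmetric_normalmx.
    apply/is_hermitianmxP; rewrite expr0 scale1r; apply/matrixP => i j.
    by rewrite !mxE /= (eq_sym (f i)) (eq_sym (g i)) (eq_sym i).
  apply/mxOverP => i j; rewrite !mxE.
  by rewrite rpredB ?rpredD ?realn // rpredMn // realn.
(* Since [h(-2) = - a b (a + b)], the coefficient 4 turns [-2] into [-2 + 4 = 2]. The roots of [h]
   are nonnegative because [a] and [b] are at least 2. *)
have abs_eig z : z \in eigenvalues A ->
    `|z| = ('X - (4 / (a * b * (a + b))) *: h).[z].
  move=> /(eigenvalue_root_horner hA0).
  rewrite hornerM hornerXsubC opprK hornerD hornerN hornerZ hornerX.
  move=> /eqP; rewrite mulf_eq0 addr_eq0 => /orP[/eqP->|h0].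
    rewrite normrN ger0_norm // /h !hornerE /=.
    by field; rewrite a0 b0 ab0.
  rewrite (eqP h0) mulr0 subr0 ger0_norm //.
  move: h0; rewrite /h !hornerE !mulf_eq0 !subr_eq0 -orbA.
  have a_ge2 : 0 <= a - 2 by rewrite subr_ge0 ler_nat.
  have b_ge2 : 0 <= b - 2 by rewrite subr_ge0 ler_nat.
  case/or3P => /eqP-> //.
  by rewrite -addrA addr_ge0 // ltW // (lt_trans ltr01).
rewrite (eq_big_seq _ abs_eig) -normal_mxtrace_horner // rmorphB /= horner_mxZ.
rewrite horner_mx_X hA.
have trU : \tr U = (a * b).
  rewrite /mxtrace; under eq_bigr do rewrite mxE eqxx.
  by rewrite sumr_const card_ord n_card natrM.
have trV : \tr V = (a * b).
  rewrite /mxtrace; under eq_bigr do rewrite mxE eqxx.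
  by rewrite sumr_const card_ord n_card natrM.
have trK : \tr K = (a * b).
  rewrite /mxtrace; under eq_bigr do rewrite mxE.
  by rewrite sumr_const card_ord n_card natrM.
(* Here [A] has trace 0 and [h(A)] has trace [- a b (a + b) (a - 1) (b - 1)]. *)
rewrite /A !(linearB, linearD, linearZ) /= !mxtrace_scalar trU trV trK.
rewrite n_card -/a -/b.
by field; rewrite a0 b0 ab0.
Qed.


(** * From rook's graphs to line graphs of complete bipartite graphs *)

Lemma energy_rook_graph (C : numClosedFieldType) (G : sgraph) (I J : finType)
    (h : G -> I * J) :
    bijective h ->
    (forall x y : G,
      adj x y = (x != y) && (((h x).1 == (h y).1) || ((h x).2 == (h y).2))) ->
    (1 < #|I|)%N -> (1 < #|J|)%N ->
  energy C G = 4 * (#|I|%:R - 1) * (#|J|%:R - 1).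
Proof.
move=> h_bij adjE I_gt1 J_gt1.
pose f (i : 'I_#|G|) := (h (enum_val i)).1.
pose g (i : 'I_#|G|) := (h (enum_val i)).2.
have fg_bij : bijective (fun i => (f i, g i)).
  apply: (@eq_bij _ _ (h \o enum_val)).
    exact: bij_comp (enum_val_bij _).
  by move=> i; rewrite /= -surjective_pairing.
rewrite -(rook_matrix_energy C fg_bij) // /energy.
congr (\sum_(z <- eigenvalues _) _).
apply/matrixP => i j; rewrite !mxE adjE (inj_eq enum_val_inj) -/(f i) -/(f j).
rewrite -/(g i) -/(g j).
(* On the diagonal [1 + 1 - 2 = 0]; off it, two cells never share both coordinates, so the sum of
   the indicators is that of the disjunction. *)
have [<-|ne] := eqVneq i j; first by rewrite !eqxx !mulr1n subrr.
rewrite subr0 -natrD; congr _%:R.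
have [ef|//] := eqVneq (f i) (f j); have [eg|//] := eqVneq (g i) (g j).
by case/eqP: ne; apply: (bij_inj fg_bij); rewrite /= ef eg.
Qed.

(** An edge amounts to a pair of endpoints, one in each part, and two edges meet when these pairs
    agree in a coordinate. *)
Lemma energy_line_complete_bipartite (C : numClosedFieldType) (G : sgraph)
    (A : {set G}) :
    (forall x y : G, adj x y = (x \in A) (+) (y \in A)) ->
    (1 < #|A|)%N -> (1 < #|~: A|)%N ->
  energy C (line_graph G) = 4 * (#|A|%:R - 1) * (#|~: A|%:R - 1).
Proof.
move=> adjE A_gt1 B_gt1.
pose I : finType := {x | x \in A}; pose J : finType := {x | x \in ~: A}.
have cardI : #|I| = #|A| by rewrite card_sig; apply: eq_card.
have cardJ : #|J| = #|~: A| by rewrite card_sig; apply: eq_card.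
have edgeP (u : I * J) : is_edge [set val u.1; val u.2].
  apply/existsP; exists (val u.1); apply/existsP; exists (val u.2).
  rewrite eqxx adjE (valP u.1) andbT.
  by have := valP u.2; rewrite inE => /negPf->.
pose k u : line_graph G := Sub _ (edgeP u).
have eqIJ (x : I) (y : J) : (val x == val y) = false.
  apply/negP => /eqP e; have := valP y.
  by rewrite inE -e (valP x).
have k_meet u v :
    (val (k u) :&: val (k v) != set0) = (u.1 == v.1) || (u.2 == v.2).
  apply/set0Pn/orP => [[z]|[/eqP e|/eqP e]].
  - rewrite !inE => /andP[/orP[]/eqP-> /orP[]]; rewrite ?eqIJ // => e.
    + by left.
    + by rewrite eq_sym eqIJ in e.
    + by right.
  - by exists (val u.1); rewrite !inE e !eqxx.
  - by exists (val u.2); rewrite !inE e !eqxx !orbT.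
have k_inj : injective k.
  move=> [x y] [x' y'] exy.
  have /setP e : [set val x; val y] = [set val x'; val y'] := congr1 val exy.
  have := e (val x); rewrite !inE eqxx !eqIJ !orbF => /esym/eqP/val_inj->.
  have := e (val y); rewrite !inE eqxx orbT ![val y == val (_ : I)]eq_sym eqIJ.
  by move/esym/eqP/val_inj->.
have [e|h hK] := fin_all_exists (_ : forall e, exists u, k u = e).
  have /existsP[x /existsP[y /andP[]]] := valP e.
  (* Edges are unordered, so the endpoint in [A] may be called [x]. *)
  rewrite adjE; wlog xA : x y / x \in A.
    move=> H; have [xA|xA] := boolP (x \in A).
      by move: (H x y xA); rewrite xA.
    move=> /= yA; move: (H y x yA); rewrite yA (negPf xA) setUC.
    exact.
  rewrite xA /= => yA /eqP e_xy.
  have yB : y \in ~: A by rewrite inE.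
  exists (Sub x xA, Sub y yB); apply: val_inj.
  by rewrite /= e_xy.
have kK : cancel k h by move=> u; apply: k_inj.
rewrite -cardI -cardJ (energy_rook_graph C (h := h)) ?cardI ?cardJ //.
  by exists k.
by move=> e e'; rewrite -k_meet !hK.
Qed.

(** * The zero-divisor graph of the integers modulo [p * q] *)

Lemma Zp_mul_eq0 n (x y : 'Z_n) : (1 < n)%N -> (x * y == 0) = (n %| x * y)%N.
Proof. by move=> n_gt1; congr (_ %% _ == 0)%N; apply: Zp_cast. Qed.

(** The residues are [d], [2 d], ..., [(m - 1) d], and [m] annihilates each of them; [k.+1] in [F]
    skips zero. *)
Lemma card_zdg_multiples n d m : (1 < d)%N -> (1 < m)%N -> n = (d * m)%N ->
  #|[set v : zdg_vertex 'Z_n | (d %| val v)%N]| = m.-1.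
Proof.
move=> d_gt1 m_gt1 nE.
have d_gt0 : (0 < d)%N by apply: ltnW.
have m_gt0 : (0 < m)%N by apply: ltnW.
have n_gt1 : (1 < n)%N by rewrite nE (leq_trans d_gt1) ?leq_pmulr.
have ltn_mul (k : 'I_m.-1) : (d * k.+1 < n)%N.
  by rewrite nE ltn_pmul2l // -ltn_predRL.
pose F (k : 'I_m.-1) : 'Z_n := inZp (d * k.+1).
have valF k : val (F k) = (d * k.+1)%N.
  by rewrite /= Zp_cast // modn_small.
have F_inj : injective F.
  move=> k l /(congr1 val); rewrite !valF => /eqP.
  by rewrite eqn_pmul2l // eqSS => /eqP/val_inj.
rewrite -[RHS]card_ord -(card_imset _ F_inj) -(card_imset _ val_inj).
apply: eq_card => x; apply/imsetP/imsetP => [[v]|[k _ ->]].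
  rewrite inE => dv ->; have /andP[v0 _] := valP v.
  have v_gt0 : (0 < val v %/ d)%N.
    rewrite divn_gt0 // dvdn_leq // lt0n.
    by apply: contra v0 => /eqP v0; apply/eqP/val_inj.
  have v_lt : ((val v %/ d).-1 < m.-1)%N.
    rewrite -ltnS !prednK // ltn_divLR // mulnC -nE.
    by have := ltn_ord (val v); rewrite [X in (_ < X)%N]Zp_cast.
  exists (Ordinal v_lt) => //; apply: val_inj.
  by rewrite valF /= prednK // mulnC divnK.
have Fk0 : nonzero_zero_divisor (F k).
  apply/andP; split.
    by rewrite -val_eqE valF /= muln_eq0 negb_or -lt0n d_gt0.
  apply/existsP; exists (inZp m); apply/andP; split.
    rewrite -val_eqE /= Zp_cast // modn_small -?lt0n //.
    by rewrite nE ltn_Pmull.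
  rewrite Zp_mul_eq0 // valF /= Zp_cast // modn_small.
    by rewrite mulnAC -nE dvdn_mulr.
  by rewrite nE ltn_Pmull.
exists (Sub (F k) Fk0); last by rewrite SubK.
by rewrite inE SubK [X in (_ %| X)%N]valF dvdn_mulr.
Qed.

Theorem theorem3p3 (C : numClosedFieldType) (p q : nat)
  (p_prime : prime p) (q_prime : prime q) (p_neq_q : p <> q)
  (p_gt2 : (2 < p)%N) (q_gt2 : (2 < q)%N) :
  energy C (line_graph (zero_divisor_graph 'Z_(p * q))) =
    4 * p%:R * q%:R - 8 * p%:R - 8 * q%:R + 16.
Proof.
set G := zero_divisor_graph _.
have p_gt1 : (1 < p)%N by apply: ltnW.
have q_gt1 : (1 < q)%N by apply: ltnW.
have n_gt1 : (1 < p * q)%N by rewrite (leq_trans p_gt1) ?leq_pmulr // ltnW.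
have co_pq : coprime p q by rewrite prime_coprime // dvdn_prime2 //; apply/eqP.
have dvd_pq (m : nat) : (p * q %| m)%N = (p %| m)%N && (q %| m)%N.
  exact: Gauss_dvd.
have dvd_pqM (x y : nat) : (p * q %| x * y)%N =
    ((p %| x)%N || (p %| y)%N) && ((q %| x)%N || (q %| y)%N).
  by rewrite dvd_pq !Euclid_dvdM.
have ndvd (x : 'Z_(p * q)) : x != 0 -> (p * q %| x)%N = false.
  move=> x0; apply/negP => /dvdn_leq.
  rewrite lt0n; move: x0; rewrite -val_eqE /= => -> /(_ isT).
  by rewrite leqNgt -[X in (_ < X)%N](Zp_cast n_gt1) ltn_ord.
(* Neither [v] nor its nonzero annihilator [y] is divisible by both primes, yet each prime divides
   one of them. *)
have q_dvd (v : G) : (q %| val v)%N = ~~ (p %| val v)%N.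
  have /andP[v0 /existsP[y /andP[y0]]] := valP v.
  rewrite Zp_mul_eq0 // dvd_pqM.
  have := ndvd _ v0; have := ndvd _ y0; rewrite !dvd_pq.
  by do 4!case: (_ %| _)%N.
pose A := [set v : G | (p %| val v)%N].
have cA : #|A| = q.-1 by apply: card_zdg_multiples.
have cB : #|~: A| = p.-1.
  rewrite -(card_zdg_multiples q_gt1 p_gt1 (mulnC p q)).
  by apply: eq_card => v; rewrite !inE q_dvd.
rewrite (energy_line_complete_bipartite C (A := A)) ?cA ?cB ?ltn_predRL //.
  (* The parts have [q - 1] and [p - 1] vertices, so the energy is [4 (q - 2) (p - 2)]. *)
  rewrite -!subn1 !natrB ?(ltnW p_gt1) ?(ltnW q_gt1) //; ring.
move=> x y; rewrite !inE /= /zdg_adj Zp_mul_eq0 // dvd_pqM !q_dvd.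
(* With [q_dvd], [x * y] vanishes exactly when [p] divides one of [x], [y] and not the other. *)
have [<-|_] := eqVneq x y; first by rewrite addbb.
by do 2!case: (_ %| _)%N.
Qed.
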